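(* Let $G$ be a group acting on a set $X$. Let $A\subseteq X$, $B\subseteq G$, $N\in\mathbb N$. Let $\mathcal D'$ be the set of finite intersections of translates $gB$ ($g\in G$). Let $\mathcal D$ be a $G$-lattice of subsets of $X$ including $A$ and $B'A$ for every $B'\in\mathcal D'$. Let $m$ be an invariant mean on $\mathcal D$ with $m(A)>0$, and let $m'$ be an invariant mean on the lattice (of subsets of $G$) generated by $\mathcal D'$, with $m'(B)>0$. Then there exists a generic, symmetric set $Y\subseteq G$ that is positively definable in $(G,\cdot,B)$ over parameters from $G$, and such that $Y^N\subseteq\mathrm{St}_1(BA)$.
   Context: A $G$-lattice of subsets of a $G$-set $X$ is a family of subsets of $X$ including $\emptyset$ and $X$, closed under $G$-translations and under intersections and unions of pairs (for $X=G$, $G$ acts by left translation). A mean on a $G$-lattice $\mathcal D$ is a non-negative, monotone, translation-invariant function $m:\mathcal D\to\mathbb R$ with $m(\emptyset)=0$ and $m(Y\cup Z)=m(Y)+m(Z)-m(Y\cap Z)$ for $Y,Z\in\mathcal D$. For $\epsilon\in\mathbb R$ and $Y\in\mathcal D$, $\mathrm{St}_\epsilon(Y):=\{g\in G:m(gY\cap Y)>(1-\epsilon)m(Y)\}$, so $\mathrm{St}_1(BA)=\{g\in G: m(gBA\cap BA)>0\}$, where $BA=\{ba:b\in B,a\in A\}$. A subset of $G$ is generic if finitely many left translates of it cover $G$; it is symmetric if it contains $1$ and is closed under inversion. $Y^N$ is the $N$-fold product set. Positively definable in $(G,\cdot,B)$ over parameters from $G$ means definable by a positive formula (built from atomic formulas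 using only $\wedge,\vee,\exists,\forall$, no negation) in the group language with a predicate for $B$, with parameters from $G$. *)

(* Defs.v *)
From HB Require Import structures.
From mathcomp Require Import all_boot all_order all_algebra.
From mathcomp Require Import boolp classical_sets cardinality reals.

Set Implicit Arguments.
Unset Strict Implicit.
Unset Printing Implicit Defensive.

Import Order.TTheory GRing.Theory Num.Theory.

Local Open Scope classical_set_scope.

(* [groupType] (boot/monoid.v) is the structure of arbitrary, possibly
   infinite, groups; the notions of action and product set from fingroup are
   only available for finite groups. *)

Record left_action (G : groupType) (X : Type) (act : G -> X -> X) : Prop :=
  LeftAction {
    left_action1 : forall x, act 1%g x = x;
    left_actionM : forall g h x, act (g * h)%g x = act g (act h x) }.

Definition left_mul (G : groupType) : G -> G -> G := fun g h => (g * h)%g.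

Definition translate (G : groupType) (X : Type) (act : G -> X -> X)
  (g : G) (Y : set X) : set X := [set act g y | y in Y].

Definition set_act (G : groupType) (X : Type) (act : G -> X -> X)
  (B : set G) (A : set X) : set X := [set act b a | b in B & a in A].

Definition set_pow (G : groupType) (Y : set G) (N : nat) : set G :=
  iter N (set_act (@left_mul G) Y) [set 1%g].

Record is_Glattice (G : groupType) (X : Type) (act : G -> X -> X)
    (D : set (set X)) : Prop := IsGlattice {
  Glattice0 : D set0;
  GlatticeT : D setT;
  Glattice_translate : forall g Y, D Y -> D (translate act g Y);
  GlatticeI : forall Y Z, D Y -> D Z -> D (Y `&` Z);
  GlatticeU : forall Y Z, D Y -> D Z -> D (Y `|` Z) }.

Definition generated_Glattice (G : groupType) (X : Type) (act : G -> X -> X)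
  (E : set (set X)) : set (set X) := smallest (is_Glattice act) E.

(* A mean on [D] is represented by a function on all subsets that is
   constrained on [D] only; its values outside [D] are irrelevant. *)
Record is_mean (R : realType) (G : groupType) (X : Type) (act : G -> X -> X)
    (D : set (set X)) (m : set X -> R) : Prop := IsMean {
  mean_ge0 : forall Y, D Y -> (0 <= m Y)%R;
  mean_mono : forall Y Z, D Y -> D Z -> Y `<=` Z -> (m Y <= m Z)%R;
  mean_translate : forall g Y, D Y -> m (translate act g Y) = m Y;
  mean0 : m set0 = 0%R;
  meanU : forall Y Z, D Y -> D Z ->
    m (Y `|` Z) = (m Y + m Z - m (Y `&` Z))%R }.

Definition stab (R : realType) (G : groupType) (X : Type) (act : G -> X -> X)
    (m : set X -> R) (eps : R) (Y : set X) : set G :=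
  [set g | ((1 - eps) * m Y < m (translate act g Y `&` Y))%R].

(* The empty intersection, which would be all of [G], is excluded. *)
Definition finite_meets (G : groupType) (B : set G) : set (set G) :=
  [set \bigcap_(g in F) translate (@left_mul G) g B
     | F in [set F : set G | finite_set F /\ F !=set0]].

Definition generic (G : groupType) (Y : set G) : Prop :=
  exists2 F : set G, finite_set F &
    \bigcup_(g in F) translate (@left_mul G) g Y = setT.

Definition symmetric_set (G : groupType) (Y : set G) : Prop :=
  Y 1%g /\ (forall g, Y g -> Y g^-1%g).

(* Terms and positive formulas of the group language with a unary predicate
   and with constants for the elements of [G].  The index [n] is the number of
   free variables; a quantifier binds variable [ord0] of its body and
   shifts the other variables by one. *)
Inductive gterm (G : Type) (n : nat) : Type :=
| GVar of 'I_n
| GParam of G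
| GOne
| GMul of gterm G n & gterm G n
| GInv of gterm G n.

Inductive pos_formula (G : Type) : nat -> Type :=
| PEq n of gterm G n & gterm G n : pos_formula G n
| PPred n of gterm G n : pos_formula G n
| PAnd n of pos_formula G n & pos_formula G n : pos_formula G n
| POr n of pos_formula G n & pos_formula G n : pos_formula G n
| PEx n of pos_formula G n.+1 : pos_formula G n
| PAll n of pos_formula G n.+1 : pos_formula G n.

Definition env_cons (G : Type) n (x : G) (e : 'I_n -> G) : 'I_n.+1 -> G :=
  fun i => oapp e x (unlift ord0 i).

Fixpoint gterm_eval (G : groupType) n (e : 'I_n -> G) (t : gterm G n) : G :=
  match t with
  | GVar i => e i
  | GParam g => g
  | GOne => 1%g
  | GMul s u => (gterm_eval e s * gterm_eval e u)%g
  | GInv s => (gterm_eval e s)^-1%g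
  end.

Fixpoint pos_sat (G : groupType) (B : set G) n (phi : pos_formula G n) :
    ('I_n -> G) -> Prop :=
  match phi in pos_formula _ n return ('I_n -> G) -> Prop with
  | PEq _ s t => fun e => gterm_eval e s = gterm_eval e t
  | PPred _ t => fun e => B (gterm_eval e t)
  | PAnd _ p q => fun e => pos_sat B p e /\ pos_sat B q e
  | POr _ p q => fun e => pos_sat B p e \/ pos_sat B q e
  | PEx _ p => fun e => exists x, pos_sat B p (env_cons x e)
  | PAll _ p => fun e => forall x, pos_sat B p (env_cons x e)
  end.

Definition positively_definable (G : groupType) (B Y : set G) : Prop :=
  exists phi : pos_formula G 1, Y = [set g | pos_sat B phi (fun=> g)].

(* Main.v *)
(* Call a set large of depth 0 if it is nonempty, and large of depth d+1 if the
   set of g such that gS `&` S is large of depth d is generic, by a prescribed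
   number of translates.  By Bonferroni's inequality for m', B is large of any
   depth T, for suitable numbers of translates.  Starting from B, replace S by
   some gS `&` S, large of one depth less, whenever this shrinks the mean of SA
   by a factor 1+h.  As m(SA) >= m(A) throughout, the process stops before the
   depth is exhausted, at a set C; then Y = {g | gC `&` C is large} is generic
   and moves CA by at most an h-fraction of its mean.  With h = 1/(N+1), products
   of N elements of Y still move CA to a set meeting it in positive mean.
   Being defined by finitely many nested quantifiers without negation, Y is
   positively definable. *)
Require Import Defs.
From HB Require Import structures.
From mathcomp Require Import all_boot all_order all_algebra.
From mathcomp Require Import boolp classical_sets cardinality reals.
From mathcomp Require Import lra.

Set Implicit Arguments.
Unset Strict Implicit.
Unset Printing Implicit Defensive.

Import Order.TTheory GRing.Theory Num.Theory.

Local Open Scope classical_set_scope.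

(** * Translates of sets, and the lattices they generate *)

Section Translates.
Variables (G : groupType) (X : Type) (act : G -> X -> X).

Lemma translateS g (Y Z : set X) :
  Y `<=` Z -> translate act g Y `<=` translate act g Z.
Proof. exact: image_subset. Qed.

Lemma set_actS (B B' : set G) (A : set X) :
  B `<=` B' -> set_act act B A `<=` set_act act B' A.
Proof. by move=> sBB' _ [b Bb [a Aa <-]]; exists b; [exact: sBB'|exists a]. Qed.

Hypothesis hact : left_action act.

(** In preimage form, translates commute with Boolean operations by computation. *)
Lemma translateE g (Y : set X) : translate act g Y = act g^-1%g @^-1` Y.
Proof.
apply/seteqP; split=> [_ [y Yy <-]|x Yx] /=.
  by rewrite -(left_actionM hact) mulVg (left_action1 hact).
by exists (act g^-1%g x) => //; rewrite -(left_actionM hact) mulgV (left_action1 hact).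
Qed.

Lemma translate1 (Y : set X) : translate act 1%g Y = Y.
Proof.
by apply/seteqP; split=> x /=; rewrite translateE /= invg1 (left_action1 hact).
Qed.

Lemma translateM g h (Y : set X) :
  translate act (g * h)%g Y = translate act g (translate act h Y).
Proof.
by apply/seteqP; split=> x; rewrite !translateE /= invgM (left_actionM hact).
Qed.

Lemma translateI g (Y Z : set X) :
  translate act g (Y `&` Z) = translate act g Y `&` translate act g Z.
Proof. by rewrite !translateE. Qed.

Lemma set_act_translate g (B : set G) (A : set X) :
  set_act act (translate (@left_mul G) g B) A = translate act g (set_act act B A).
Proof.
apply/seteqP; split=> [_ [_ [b Bb <-] [a Aa <-]]|_ [_ [b Bb [a Aa <-]] <-]].
  exists (act b a); first by exists b => //; exists a.
  by rewrite /left_mul (left_actionM hact).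
exists (left_mul g b); first by exists b.
by exists a => //; rewrite /left_mul (left_actionM hact).
Qed.

End Translates.

Lemma left_mul_action (G : groupType) : left_action (@left_mul G).
Proof. by split=> [x|g h x]; rewrite /left_mul ?mul1g ?mulgA. Qed.

Lemma generated_is_Glattice (G : groupType) (X : Type) (act : G -> X -> X)
  (E : set (set X)) : is_Glattice act (generated_Glattice act E).
Proof.
split.
- by move=> D [hD _]; exact: Glattice0 hD.
- by move=> D [hD _]; exact: GlatticeT hD.
- by move=> g Y hY D [hD sED]; apply: (Glattice_translate hD); exact: hY.
- by move=> Y Z hY hZ D [hD sED]; apply: (GlatticeI hD); [exact: hY|exact: hZ].
- by move=> Y Z hY hZ D [hD sED]; apply: (GlatticeU hD); [exact: hY|exact: hZ].
Qed.

(** * Means and overlaps of translates *)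

Section MeanTranslates.
Local Open Scope ring_scope.
Variables (R : realType) (G : groupType) (X : Type) (act : G -> X -> X).
Hypothesis hact : left_action act.
Variables (D : set (set X)) (m : set X -> R).
Hypotheses (hD : is_Glattice act D) (hm : is_mean act D m).

Lemma mean_subadd Y Z : D Y -> D Z -> m (Y `|` Z) <= m Y + m Z.
Proof.
move=> DY DZ; rewrite (meanU hm) //.
have := mean_ge0 hm (GlatticeI hD DY DZ); lra.
Qed.

(* Otherwise one greedily picks k.+1 translates of mean at least t with pairwise
   intersections of mean at most s = (k.+1)^-2; their union would then have mean
   at least (k.+1) t - (k.+1)^2 s > m(X). *)
Lemma mean_cover (t : R) : 0 < t ->
  exists k : nat, exists2 s : R, 0 < s &
    forall S, D S -> t <= m S ->
    exists2 xs : seq G, size xs = k.+1 &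
      forall y, exists2 x, x \in xs &
        s <= m (translate act (x^-1 * y)%g S `&` S).
Proof.
move=> t_gt0; pose M := m setT.
(* Then $(k+1)t > m(X)+1$, while with $s=(k+1)^{-2}$ the overlaps cost at most 1. *)
pose k := Num.truncn ((M + 1) / t).
have hk : M + 1 < k.+1%:R * t by rewrite -ltr_pdivrMr // truncnS_gt.
exists k; exists ((k.+1%:R ^+ 2)^-1); first by rewrite invr_gt0 exprn_gt0 ?ltr0n.
set s := _^-1 => S DS tS.
have s_gt0 : 0 < s by rewrite invr_gt0 exprn_gt0 ?ltr0n.
have DT g : D (translate act g S) by exact: (Glattice_translate hD _ DS).
apply: contrapT => nocover.
have pick xs : size xs = k.+1 -> exists y, forall x, x \in xs ->
    m (translate act y S `&` translate act x S) < s.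
  move=> sz; apply: contrapT => H; apply: nocover; exists xs => // y.
  apply: contrapT => H2; apply: H; exists y => x xxs.
  rewrite ltNge; apply/negP => le; apply: H2; exists x => //.
  apply: le_trans le _; rewrite -(mean_translate hm x (GlatticeI hD (DT _) DS)).
  by rewrite (translateI hact) -(translateM hact) mulVKg.
(* The next translate is not yet known, so the overlap with [U] is controlled for every admissible
   [Z]. *)
have greedy j : (j <= k.+1)%N -> exists2 xs : seq G, size xs = j &
    exists U, [/\ D U, j%:R * t - j%:R ^+ 2 * s <= m U &
      forall Z, D Z -> (forall x, x \in xs -> m (Z `&` translate act x S) <= s) ->
        m (Z `&` U) <= j%:R * s].
  elim: j => [_|j IH jk].
    exists [::] => //; exists set0; split; first exact: Glattice0 hD.
      by rewrite (mean0 hm); lra.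
    by move=> Z _ _; rewrite setI0 (mean0 hm); lra.
  have [xs sz [U [DU mU ZU]]] := IH (ltnW jk).
  (* [pick] takes lists of length exactly [k.+1], hence the padding by 1. *)
  have [|y hy] := pick (xs ++ nseq (k.+1 - j) 1%g).
    by rewrite size_cat size_nseq sz subnKC // ltnW.
  exists (y :: xs); first by rewrite /= sz.
  exists (translate act y S `|` U); split; first exact: (GlatticeU hD (DT _) DU).
    rewrite (meanU hm) // (mean_translate hm) //.
    have : m (translate act y S `&` U) <= j%:R * s.
      by apply: ZU => // x xxs; apply/ltW/hy; rewrite mem_cat xxs.
    rewrite -addn1 natrD expr2; rewrite expr2 in mU.
    have : 0 <= j%:R :> R by [].
    nra.
  move=> Z DZ hZ; rewrite setIUr.
  have := mean_subadd (GlatticeI hD DZ (DT y)) (GlatticeI hD DZ DU).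
  have := hZ y (mem_head _ _).
  have : m (Z `&` U) <= j%:R * s.
    by apply: ZU => // x xxs; apply: hZ; rewrite inE xxs orbT.
  by rewrite -addn1 natrD; lra.
have [_ _ [U [DU + _]]] := greedy k.+1 (leqnn _).
have := mean_mono hm DU (GlatticeT hD) (subsetT U).
rewrite mulfV ?expf_neq0 ?pnatr_eq0 // -/M; lra.
Qed.

End MeanTranslates.

(* Iterated genericity.  Bounding the number of translates at each level by ks
   is what makes the notion first-order, and asking for k.+1 of them avoids the
   empty disjunction, which need not be positively definable. *)
Fixpoint large (G : groupType) (ks : seq nat) (S : set G) : Prop :=
  match ks with
  | [::] => S !=set0
  | k :: ks' => exists2 xs : seq G, size xs = k.+1 &
      forall y, exists2 x, x \in xs &
        large ks' (translate (@left_mul G) (x^-1 * y)%g S `&` S)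
  end.

(** * Largeness: invariance, genericity, and existence from a mean *)

Section Large.
Variable G : groupType.
Implicit Types (S T : set G) (ks : seq nat).
Local Notation tr := (translate (@left_mul G)).
Local Notation trM := (translateM (@left_mul_action G)).
Local Notation tr1 := (translate1 (@left_mul_action G)).
Local Notation trI := (translateI (@left_mul_action G)).

Lemma largeS ks S T : S `<=` T -> large ks S -> large ks T.
Proof.
elim: ks S T => [|k ks IH] S T sST /=; first exact: subset_nonempty.
case=> xs sz H; exists xs => // y; have [x xxs L] := H y; exists x => //.
by apply: IH L; apply: setISS => //; apply: translateS.
Qed.

Lemma large_translate ks g S : large ks S -> large ks (tr g S).
Proof.
elim: ks S => [|k ks IH] S /=; first by case=> x Sx; exists (left_mul g x); exists x.
(* With these elements, the intersection to be tested for $gS$ at $y$ is the $g$-translate of the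
   one for $S$ at $yg$. *)
case=> xs sz H; exists [seq (x * g^-1)%g | x <- xs]; first by rewrite size_map.
move=> y; have [x xxs L] := H (y * g)%g.
exists (x * g^-1)%g; first exact: map_f.
suff -> : tr ((x * g^-1)^-1 * y)%g (tr g S) `&` tr g S =
    tr g (tr (x^-1 * (y * g))%g S `&` S) by exact: IH.
by rewrite trI -!trM invgM invgK !mulgA.
Qed.

Lemma large_behead k ks S : large (k :: ks) S -> large ks S.
Proof.
move=> [xs _ /(_ 1%g) [x _]]; apply: largeS; exact: subIsetr.
Qed.

Lemma large_nonempty ks S : large ks S -> S !=set0.
Proof. by elim: ks => // k ks IH /large_behead. Qed.

Definition large_stab ks S : set G := [set g | large ks (tr g S `&` S)].

Lemma large_stab_generic k ks S : large (k :: ks) S -> generic (large_stab ks S).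
Proof.
move=> [xs _ H]; exists [set` xs]; first by apply/finite_seqP; exists xs.
rewrite -subTset => y _; have [x xxs L] := H y.
by exists x => //; exists (x^-1 * y)%g => //; rewrite /left_mul mulVKg.
Qed.

(** Translation by $g^{-1}$ carries $gS\cap S$ to $S\cap g^{-1}S$. *)
Lemma large_stab_symmetric k ks S :
  large (k :: ks) S -> symmetric_set (large_stab ks S).
Proof.
move=> LS; split; first by rewrite /large_stab /= tr1 setIid; exact: large_behead LS.
move=> g /(large_translate g^-1%g).
by rewrite /large_stab /= trI -trM mulVg tr1 setIC.
Qed.

(** Iterates [mean_cover], the threshold [s] of one level serving as [t] for the next. Since [k] and
    [s] depend on [t] but not on [S], one list [ks] serves all [S]. *)
Lemma mean_large (R : realType) (D : set (set G)) (m : set G -> R)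
  (hD : is_Glattice (@left_mul G) D) (hm : is_mean (@left_mul G) D m)
  (T : nat) (t : R) : (0 < t)%R ->
  exists2 ks, size ks = T & forall S, D S -> (t <= m S)%R -> large ks S.
Proof.
elim: T t => [|T IH] t t_gt0.
  exists [::] => // S DS tS /=; apply/set0P/eqP => S0.
  by move: tS; rewrite S0 (mean0 hm) leNgt t_gt0.
have [k [s s_gt0 cover]] := mean_cover (@left_mul_action G) hD hm t_gt0.
have [ks sz L] := IH s s_gt0; exists (k :: ks); first by rewrite /= sz.
move=> S DS tS; have [xs szx H] := cover S DS tS; exists xs => // y.
have [x xxs mx] := H y; exists x => //; apply: L => //.
exact: (GlatticeI hD (Glattice_translate hD _ DS) DS).
Qed.

End Large.

(** * Finite intersections of translates, coded by lists *)

Section Meets.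
Variables (G : groupType) (B : set G).
Local Notation tr := (translate (@left_mul G)).

(** The entries of the list can be named by terms of the language. The empty list codes all of
    $G$. *)
Definition meet_translates (cs : seq G) : set G :=
  [set x | forall c, c \in cs -> B (c^-1 * x)%g].

Lemma finite_meetsP (S : set G) :
  finite_meets B S <-> exists2 cs, cs != [::] & S = meet_translates cs.
Proof.
have E cs : \bigcap_(g in [set` cs]) tr g B = meet_translates cs.
  apply/seteqP; split=> x H c ccs; have := H c ccs;
  by rewrite (translateE (@left_mul_action G)).
split=> [[F [/finite_seqP [cs ->] [c ccs]] <-]|[cs ncs ->]].
  by exists cs; rewrite ?E //; case: cs ccs.
exists [set` cs] => //; split; first by apply/finite_seqP; exists cs.
by case: cs ncs => [//|c cs _]; exists c; rewrite /= mem_head.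
Qed.

(** Together with [meet_translatesI], this turns the passage from $S$ to $gS\cap S$ into an
    operation on lists. *)
Lemma translate_meet_translates g cs :
  tr g (meet_translates cs) = meet_translates [seq g * c | c <- cs]%g.
Proof.
rewrite (translateE (@left_mul_action G)); apply/seteqP; split=> x /= H c.
  by move=> /mapP [d dcs ->]; rewrite invgM -mulgA; exact: H.
by move=> ccs; have := H (g * c)%g (map_f _ ccs); rewrite invgM -mulgA.
Qed.

Lemma meet_translatesI cs ds :
  meet_translates cs `&` meet_translates ds = meet_translates (cs ++ ds).
Proof.
apply/seteqP; split=> x /=.
  by case=> Hc Hd c; rewrite mem_cat => /orP[/Hc|/Hd].
by move=> H; split=> c ccs; apply: H; rewrite mem_cat ccs ?orbT.
Qed.

Lemma finite_meets_translateI g S :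
  finite_meets B S -> finite_meets B (tr g S `&` S).
Proof.
move=> /finite_meetsP [cs ncs ->]; apply/finite_meetsP.
rewrite translate_meet_translates meet_translatesI; eexists; last reflexivity.
by case: cs ncs.
Qed.

Lemma finite_meets_self : finite_meets B B.
Proof.
apply/finite_meetsP; exists [:: 1%g] => //; apply/seteqP; split=> x.
  by move=> Bx c; rewrite inE => /eqP ->; rewrite invg1 mul1g.
by move=> /(_ 1%g); rewrite inE eqxx invg1 mul1g; exact.
Qed.

End Meets.


(** * Positive definability of largeness *)

Section Definability.
Variables (G : groupType) (B : set G).

Fixpoint gterm_lift n (t : gterm G n) : gterm G n.+1 :=
  match t with
  | GVar i => GVar G (lift ord0 i)
  | GParam g => GParam _ g
  | GOne => GOne _ _
  | GMul s u => GMul (gterm_lift s) (gterm_lift u)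
  | GInv s => GInv (gterm_lift s)
  end.

Lemma gterm_eval_lift n x (e : 'I_n -> G) t :
  gterm_eval (env_cons x e) (gterm_lift t) = gterm_eval e t.
Proof.
elim: t => [i|g||s /= -> u /= ->|s /= ->] //=.
by rewrite /env_cons liftK.
Qed.

Lemma gterm_eval_lifts n x (e : 'I_n -> G) ts :
  map (gterm_eval (env_cons x e)) (map (@gterm_lift n) ts) = map (gterm_eval e) ts.
Proof. by rewrite -map_comp; apply: eq_map => t; exact: gterm_eval_lift. Qed.

Lemma gterm_eval_var0 n x (e : 'I_n -> G) :
  gterm_eval (env_cons x e) (GVar G ord0) = x.
Proof. by rewrite /= /env_cons unlift_none. Qed.

(** A semantic form of definability: closure under connectives and quantifiers replaces writing out
    formulas. *)
Definition pos_pred n (P : ('I_n -> G) -> Prop) :=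
  exists phi : pos_formula G n, forall e, pos_sat B phi e <-> P e.

Lemma pos_pred_ext n (P Q : ('I_n -> G) -> Prop) :
  (forall e, P e <-> Q e) -> pos_pred P -> pos_pred Q.
Proof. by move=> PQ [phi H]; exists phi => e; rewrite H. Qed.

Lemma pos_pred_and n (P Q : ('I_n -> G) -> Prop) :
  pos_pred P -> pos_pred Q -> pos_pred (fun e => P e /\ Q e).
Proof. by move=> [p Hp] [q Hq]; exists (PAnd p q) => e /=; rewrite Hp Hq. Qed.

Lemma pos_pred_or n (P Q : ('I_n -> G) -> Prop) :
  pos_pred P -> pos_pred Q -> pos_pred (fun e => P e \/ Q e).
Proof. by move=> [p Hp] [q Hq]; exists (POr p q) => e /=; rewrite Hp Hq. Qed.

Lemma pos_pred_exists n (P : G -> ('I_n -> G) -> Prop) (Q : ('I_n.+1 -> G) -> Prop) :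
  (forall x e, Q (env_cons x e) <-> P x e) -> pos_pred Q ->
  pos_pred (fun e => exists x, P x e).
Proof.
move=> QP [phi H]; exists (PEx phi) => e /=.
by split=> -[x Hx]; exists x; apply/QP/H || apply/H/QP.
Qed.

Lemma pos_pred_forall n (P : G -> ('I_n -> G) -> Prop) (Q : ('I_n.+1 -> G) -> Prop) :
  (forall x e, Q (env_cons x e) <-> P x e) -> pos_pred Q ->
  pos_pred (fun e => forall x, P x e).
Proof.
move=> QP [phi H]; exists (PAll phi) => e /=.
by split=> Hx x; have := Hx x; rewrite H QP.
Qed.

Lemma pos_pred_all_in n (P : G -> ('I_n -> G) -> Prop) (ts : seq (gterm G n)) :
  (forall t, pos_pred (fun e => P (gterm_eval e t) e)) ->
  pos_pred (fun e => forall x, x \in map (gterm_eval e) ts -> P x e).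
Proof.
(* The empty conjunction is expressed by $1=1$. *)
move=> H; elim: ts => [|t ts IH]; first by exists (PEq (GOne G n) (GOne G n)).
apply: pos_pred_ext (pos_pred_and (H t) IH) => e; split=> /=.
  by move=> [Pt Pts] x; rewrite inE => /orP[/eqP ->|/Pts].
by move=> Pts; split=> [|x xts]; apply: Pts; rewrite inE ?eqxx ?xts ?orbT.
Qed.

Lemma pos_pred_exists_in n (P : G -> ('I_n -> G) -> Prop) (ts : seq (gterm G n)) :
  (forall t, pos_pred (fun e => P (gterm_eval e t) e)) -> ts <> [::] ->
  pos_pred (fun e => exists2 x, x \in map (gterm_eval e) ts & P x e).
Proof.
move=> H; case: ts => // t ts _; elim: ts t => [|u ts IH] t.
  apply: pos_pred_ext (H t) => e; split=> /=.
    by move=> Pt; eexists; [exact: mem_head|].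
  by move=> [x]; rewrite inE => /eqP ->.
apply: pos_pred_ext (pos_pred_or (H t) (IH u)) => e; split.
  move=> [Pt|[x xts Px]]; first by eexists; [exact: mem_head|].
  by exists x => //; rewrite map_cons in_cons xts orbT.
move=> [x]; rewrite map_cons in_cons => /orP[/eqP -> Pt|xts Px]; first by left.
by right; exists x.
Qed.

(* [as_] collects the variables bound by the existential quantifiers already
   introduced. *)
Lemma pos_pred_cover ks (IHks : forall n (ts : seq (gterm G n)),
    pos_pred (fun e => large ks (meet_translates B (map (gterm_eval e) ts))))
  k n (as_ ts : seq (gterm G n)) : as_ <> [::] \/ (0 < k)%N ->
  pos_pred (fun e => exists2 xs : seq G, size xs = k &
    forall y, exists2 x, x \in map (gterm_eval e) as_ ++ xs &
      large ks (translate (@left_mul G) (x^-1 * y)%g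
                  (meet_translates B (map (gterm_eval e) ts))
                `&` meet_translates B (map (gterm_eval e) ts))).
Proof.
elim: k n as_ ts => [|k IH] n as_ ts as_k.
  have {as_k} as_n : as_ <> [::] by case: as_k.
  apply: (@pos_pred_ext _ (fun e => forall y, exists2 x, x \in map (gterm_eval e) as_ &
      large ks (translate (@left_mul G) (x^-1 * y)%g
                  (meet_translates B (map (gterm_eval e) ts))
                `&` meet_translates B (map (gterm_eval e) ts)))).
    move=> e; split=> [H|[xs /size0nil ->]]; last by rewrite cats0.
    by exists [::] => //; rewrite cats0.
  pose ts' := map (@gterm_lift n) ts.
  apply: (@pos_pred_forall _ _ (fun e =>
    exists2 x, x \in map (gterm_eval e) (map (@gterm_lift n) as_) &
      large ks (translate (@left_mul G) (x^-1 * e ord0)%g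
                  (meet_translates B (map (gterm_eval e) ts'))
                `&` meet_translates B (map (gterm_eval e) ts')))).
    by move=> y e; rewrite !gterm_eval_lifts /env_cons unlift_none.
  apply: pos_pred_exists_in; last by case: as_ as_n.
  move=> t.
  (* The intersection is again a meet of translates of [B], coded by these terms, with [y] as
     variable 0. *)
  apply: pos_pred_ext (IHks _
    (map (GMul (GMul (GInv t) (GVar G ord0))) ts' ++ ts')) => e.
  rewrite translate_meet_translates meet_translatesI map_cat.
  have -> : map (gterm_eval e) [seq GMul (GMul (GInv t) (GVar G ord0)) i | i <- ts'] =
      [seq (gterm_eval e t)^-1 * e ord0 * c | c <- map (gterm_eval e) ts']%g.
    by rewrite -!map_comp.
  by [].
(* The head of [xs] becomes the bound variable 0 and joins [as_]. *)
have H := IH n.+1 (GVar G ord0 :: map (@gterm_lift n) as_) (map (@gterm_lift n) ts)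
  (or_introl _).
apply: pos_pred_ext (pos_pred_exists (P := fun x e => exists2 xs : seq G, size xs = k &
    forall y, exists2 z, z \in x :: map (gterm_eval e) as_ ++ xs &
      large ks (translate (@left_mul G) (z^-1 * y)%g
                  (meet_translates B (map (gterm_eval e) ts))
                `&` meet_translates B (map (gterm_eval e) ts))) _ (H _)) => //.
  move=> e; split.
    move=> [x [xs sz Hxs]]; exists (x :: xs); first by rewrite /= sz.
    move=> y; have [z zxs L] := Hxs y; exists z => //.
    by rewrite mem_cat !inE orbCA -mem_cat -in_cons.
  move=> [[|x xs] //= [sz] Hxs]; exists x; exists xs => // y.
  have [z zxs L] := Hxs y; exists z => //.
  by rewrite in_cons mem_cat orbCA -in_cons -mem_cat.
by move=> x e; rewrite map_cons gterm_eval_var0 !gterm_eval_lifts.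
Qed.

(** Terms in any number of variables are allowed because inner levels of [large] involve the
    variables bound at outer ones. *)
Lemma pos_pred_large ks n (ts : seq (gterm G n)) :
  pos_pred (fun e => large ks (meet_translates B (map (gterm_eval e) ts))).
Proof.
elim: ks n ts => [|k ks IH] n ts.
  apply: (@pos_pred_exists _ _ (fun e => forall c,
      c \in map (gterm_eval e) (map (@gterm_lift n) ts) -> B (c^-1 * e ord0)%g)).
    by move=> x e; rewrite gterm_eval_lifts /env_cons unlift_none.
  by apply: pos_pred_all_in => t; exists (PPred (GMul (GInv t) (GVar G ord0))).
by apply: (pos_pred_cover IH (as_ := [::])); right.
Qed.

Lemma large_stab_definable ks S :
  finite_meets B S -> positively_definable B (large_stab ks S).
Proof.
move=> /finite_meetsP [cs _ ->].
(* These terms code $gS\cap S$, with $g$ the free variable and the entries of [cs] as parameters. *)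
have [phi H] := pos_pred_large ks
  ([seq GMul (GVar G ord0) (GParam 1 c) | c <- cs] ++ map (GParam 1) cs).
have E g : map (gterm_eval (fun=> g) \o GParam 1) cs = cs by exact: map_id.
exists phi; apply/seteqP; split=> g /=;
by rewrite /large_stab /= H map_cat -!map_comp E translate_meet_translates
           meet_translatesI.
Qed.

End Definability.

(** * Almost stabilizers and the descent *)

Section Stabilizer.
Local Open Scope ring_scope.
Variables (R : realType) (G : groupType) (X : Type) (act : G -> X -> X).
Hypothesis hact : left_action act.
Variables (D : set (set X)) (m : set X -> R).
Hypotheses (hD : is_Glattice act D) (hm : is_mean act D m).

(** For a product $yg$, the sets $ygW\cap yW$ and $yW\cap W$ both lie in $yW$, of mean $m(W)$, so
    the fractions they miss add up; their intersection lies in $ygW\cap W$. *)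
Lemma mean_set_pow (eps : R) (Y : set G) (W : set X) : D W ->
  (forall g, Y g -> (1 - eps) * m W <= m (translate act g W `&` W)) ->
  forall N g, set_pow Y N g ->
    (1 - N%:R * eps) * m W <= m (translate act g W `&` W).
Proof.
move=> DW YW; have DT g : D (translate act g W) by exact: (Glattice_translate hD _ DW).
elim=> [_ ->|N IH _ [y Yy [g /IH gN <-]]].
  by rewrite (translate1 hact) setIid; lra.
have Dg := GlatticeI hD (DT g) DW; have Dy := GlatticeI hD (DT y) DW.
have Dyg := Glattice_translate hD y Dg.
rewrite -(mean_translate hm y Dg) in gN; have := YW y Yy.
have := meanU hm Dyg Dy.
rewrite /left_mul (translateM hact) (translateI hact) in gN Dyg *.
set P := translate act y (translate act g W) in gN Dyg *.
set Q := translate act y W in gN Dyg Dy *.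
have DP : D P by exact: (Glattice_translate hD _ (DT g)).
have sU : m (P `&` Q `|` Q `&` W) <= m Q.
  apply: (mean_mono hm (GlatticeU hD Dyg Dy) (DT y)).
  by move=> x [[_ Qx]|[Qx _]].
have sI : m ((P `&` Q) `&` (Q `&` W)) <= m (P `&` W).
  apply: (mean_mono hm (GlatticeI hD Dyg Dy) (GlatticeI hD DP DW)).
  by move=> x [[? _] [_ ?]].
have : m Q = m W by exact: (mean_translate hm y DW).
by rewrite -natr1; lra.
Qed.

Variables (A : set X) (B : set G).
Hypotheses (hA : D A) (hBA : forall B', finite_meets B B' -> D (set_act act B' A)).

Lemma mean_le_set_act S : S !=set0 -> finite_meets B S -> m A <= m (set_act act S A).
Proof.
move=> [s Ss] fS; rewrite -(mean_translate hm s hA).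
apply: (mean_mono hm (Glattice_translate hD _ hA) (hBA fS)) => _ [a Aa <-].
by exists s => //; exists a.
Qed.

(* As long as some g in the large stabilizer shrinks the mean of SA by a factor
   1+h, pass from S to gS `&` S; nonemptiness bounds the number of such steps. *)
Lemma large_descent (h : R) ks S : 0 < h -> large ks S -> finite_meets B S ->
  m (set_act act S A) < (1 + h) ^+ size ks * m A ->
  exists k ks' C, [/\ large (k :: ks') C, finite_meets B C, C `<=` S &
    forall g, large_stab ks' C g -> m (set_act act C A) <=
      (1 + h) * m (translate act g (set_act act C A) `&` set_act act C A)].
Proof.
move=> h_gt0; elim: ks S => [|k ks IH] S LS fS.
  (* At depth 0 the bound reads $m(SA)<m(A)$, impossible as $SA$ contains a translate of $A$. *)
  by rewrite expr0 mul1r ltNge mean_le_set_act.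
move=> mS; have [[g Lg mg]|H] := pselect (exists2 g, large_stab ks S g &
    (1 + h) * m (set_act act (translate (@left_mul G) g S `&` S) A)
      <= m (set_act act S A)).
  have fg := finite_meets_translateI g fS.
  have [|k' [ks' [C [LC fC sC HC]]]] := IH _ Lg fg.
    rewrite -(ltr_pM2l (_ : 0 < 1 + h)); last lra.
    by rewrite mulrA -exprS; exact: le_lt_trans mS.
  by exists k', ks', C; split=> // x /sC [].
(* No [g] shrinks the mean enough, so the descent stops at [S]; the bound passes from $(gS\cap S)A$
   to the larger $gSA\cap SA$. *)
exists k, ks, S; split=> // g Lg; rewrite leNgt; apply/negP => lt.
apply: H; exists g => //; apply: ltW; apply: le_lt_trans lt.
rewrite ler_pM2l; last lra.
have DS := hBA fS.
apply: (mean_mono hm (hBA (finite_meets_translateI g fS))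
          (GlatticeI hD (Glattice_translate hD _ DS) DS)).
rewrite -(set_act_translate hact) subsetI.
by split; apply: set_actS; [exact: subIsetl|exact: subIsetr].
Qed.

End Stabilizer.

(** * Choice of constants and conclusion *)

Lemma bernoulli_ineq (R : realType) (h : R) n :
  (0 <= h -> 1 + h * n%:R <= (1 + h) ^+ n)%R.
Proof.
move=> h0; elim: n => [|n IH]; first by rewrite expr0; lra.
have : (0 <= n%:R :> R)%R by [].
by rewrite exprS -natr1; nra.
Qed.

Theorem proposition3p11 (R : realType) (G : groupType) (X : Type)
    (act : G -> X -> X) (hact : left_action act)
    (A : set X) (B : set G) (N : nat)
    (D : set (set X)) (hD : is_Glattice act D)
    (hA : D A) (hBA : forall B', finite_meets B B' -> D (set_act act B' A))
    (m : set X -> R) (hm : is_mean act D m) (hmA : (0 < m A)%R)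
    (m' : set G -> R)
    (hm' : is_mean (@left_mul G)
             (generated_Glattice (@left_mul G) (finite_meets B)) m')
    (hmB : (0 < m' B)%R) :
  exists Y : set G,
    [/\ generic Y, symmetric_set Y, positively_definable B Y
      & set_pow Y N `<=` stab act m 1%R (set_act act B A)].
Proof.
pose h : R := (N.+1%:R^-1)%R.
have h_gt0 : (0 < h)%R by rewrite invr_gt0 ltr0n.
(* Then $(T+1)h\,m(A) > m(BA)$, and Bernoulli's inequality gives [hT]. *)
pose T := Num.truncn (m (set_act act B A) / m A / h)%R.
have hT : (m (set_act act B A) < (1 + h) ^+ T.+1 * m A)%R.
  have : (m (set_act act B A) / m A / h < T.+1%:R)%R by exact: truncnS_gt.
  rewrite !ltr_pdivrMr // => /lt_trans; apply.
  rewrite ltr_pM2r // mulrC.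
  by have := bernoulli_ineq T.+1 (ltW h_gt0); lra.
have fB := finite_meets_self B.
have DB : generated_Glattice (@left_mul G) (finite_meets B) B by move=> D' [_ ]; exact.
have [ks sz Lks] := mean_large (@generated_is_Glattice _ _ _ _) hm' T.+1 hmB.
have [|k [ks' [C [LC fC sC stabC]]]] :=
  large_descent hact hD hm hA hBA h_gt0 (Lks B DB (lexx _)) fB.
  by rewrite sz.
exists (large_stab ks' C); split.
- exact: large_stab_generic LC.
- exact: large_stab_symmetric LC.
- exact: large_stab_definable.
have DCA := hBA _ fC; have DBA := hBA _ fB.
have C0 : C !=set0 by exact: large_nonempty LC.
have mC : (0 < m (set_act act C A))%R.
  exact: lt_le_trans hmA (mean_le_set_act hD hm hA hBA C0 fC).
have sCB : set_act act C A `<=` set_act act B A by exact: set_actS.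
have DT g W : D W -> D (translate act g W) by exact: Glattice_translate hD g _.
(* For $\epsilon=1$ the threshold is 0, so by monotonicity it suffices that $gCA\cap CA$ has
   positive mean. *)
move=> g gN; rewrite /stab /= subrr mul0r.
have : (m (translate act g (set_act act C A) `&` set_act act C A) <=
        m (translate act g (set_act act B A) `&` set_act act B A))%R.
  apply: (mean_mono hm (GlatticeI hD (DT _ _ DCA) DCA) (GlatticeI hD (DT _ _ DBA) DBA)).
  by apply: setISS => //; exact: translateS.
apply: lt_le_trans.
have step y : large_stab ks' C y -> ((1 - h) * m (set_act act C A) <=
    m (translate act y (set_act act C A) `&` set_act act C A))%R.
  (* From $w\le(1+h)p$ and $p\le w$ follows $p\ge w-hp\ge(1-h)w$. *)
  move=> /stabC.
  have := mean_mono hm (GlatticeI hD (DT y _ DCA) DCA) DCA (@subIsetr _ _ _).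
  set p := m (_ `&` _); set w := m _ => pw wp.
  have : (h * p <= h * w)%R by rewrite ler_pM2l.
  by lra.
apply: lt_le_trans (mean_set_pow hact hD hm DCA step gN).
(* Here $Nh=N/(N+1)<1$. *)
rewrite mulr_gt0 // subr_gt0 /h ltr_pdivrMr ?ltr0n // mul1r ltr_nat.
exact: ltnSn.
Qed.
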